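(* Let $r \geq 1$ be an integer and let $t = 1260r + 169$. Then for every integer $n \geq \frac{2119}{4}t^2 + 87978t + \frac{15957}{4}$, $$f(n) \geq n + \frac{107}{3}t + \frac{7}{3}.$$ Moreover, it is not true that $\lim_{n \to \infty} \frac{f(n) - n}{\sqrt{n}} = \sqrt{2.4}$.
   Context: For a positive integer $n$, $f(n)$ denotes the maximum number of edges in a (simple) graph on $n$ vertices in which no two cycles have the same length (i.e., all cycles in the graph have pairwise distinct lengths). *)

(* Defs.v *)
From mathcomp Require Import all_boot boolp.

Set Implicit Arguments.
Unset Strict Implicit.
Unset Printing Implicit Defensive.

Section Graphs.
Variable T : finType.
Implicit Types (E : {set {set T}}) (c : seq T).

(* A simple graph with vertex type T is given by its set of edges, each of
   which is a two-element set of vertices. *)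
Definition is_simple_graph E : bool := [forall e in E, #|e| == 2].

Definition adj E : rel T := fun x y => [set x; y] \in E.

(* The sequence [:: x_0; ...; x_(k-1)] traces the cycle x_0 x_1 ... x_(k-1) x_0,
   whose length is k >= 3. *)
Definition is_cycle E c : bool := (2 < size c) && ucycleb (adj E) c.

Definition cycle_edges c : {set {set T}} := [set [set x; next c x] | x in c].

(* A cycle is a subgraph: rotations and reversals of a vertex sequence trace the
   same cycle, so cycles are compared through their edge sets. *)
Definition distinct_cycle_lengths E : Prop :=
  forall c1 c2 : seq T, is_cycle E c1 -> is_cycle E c2 ->
    cycle_edges c1 <> cycle_edges c2 -> size c1 <> size c2.

End Graphs.

Definition f (n : nat) : nat :=
  \max_(E : {set {set 'I_n}} | `[< is_simple_graph E /\ distinct_cycle_lengths E >])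
    #|E|.

(* Main.v *)
(* A fan is a path together with spokes joining some of its vertices to a root
   vertex x; a theta graph and a cycle through x are small fans.  Glue fans at
   x.  Deleting x leaves a forest, so a cycle is determined by the two
   neighbours of x on it: if spoke j has length a_j and ends at position p_j,
   its length is u_j - v_i for some i < j in one fan, where u = p + a and
   v = p - a.  Each spoke beyond the first of its fan adds one to the number of
   edges minus the number of vertices.

   The extremal graphs blow up one finite design: a fan with foot
   (t+3)(U+V) + i + e and arm (t+3)(U-V) + i is used for t consecutive values
   of i, and its cycles have lengths 2(t+3)(U_j - V_i) + 2i +- (0 or 1).  These
   are all distinct as soon as the cells (U_j - V_i, parity of e_i + e_j) of the
   design are.  The design, found by computer, has 48 spokes and fills the cells
   perfectly; it gives 48 t extra edges on 954 t^2 + O(t) vertices, and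
   48^2 / 954 = 2.4150... exceeds (107/3)^2 / (2119/4) = 2.4013... > 2.4. *)
Require Import Defs.
From mathcomp Require Import all_boot all_order all_algebra boolp.
From mathcomp Require Import zify ring lra.

Set Implicit Arguments.
Unset Strict Implicit.
Unset Printing Implicit Defensive.

(** * Cycles as edge sets *)

Lemma cycle_edges_rot (T : finType) k (c : seq T) :
  uniq c -> cycle_edges (rot k c) = cycle_edges c.
Proof.
move=> Uc; apply/setP => e.
apply/imsetP/imsetP => -[x xc ->]; exists x; rewrite ?mem_rot // ?next_rot //.
by rewrite -(mem_rot k).
Qed.

Lemma cycle_edges_rev (T : finType) (c : seq T) :
  uniq c -> cycle_edges (rev c) = cycle_edges c.
Proof.
move=> Uc; apply/setP => e; apply/imsetP/imsetP => -[x xc ->].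
  exists (prev c x); first by rewrite mem_prev -mem_rev.
  by rewrite next_rev // next_prev // setUC.
exists (next c x); first by rewrite mem_rev mem_next.
by rewrite next_rev // prev_next // setUC.
Qed.

Lemma cycle_edges_map (T1 T2 : finType) (h : T1 -> T2) (c : seq T1) :
  injective h -> uniq c ->
  cycle_edges (map h c) = (fun e : {set T1} => h @: e) @: cycle_edges c.
Proof.
move=> injh Uc; apply/setP => e; apply/imsetP/imsetP.
  case=> _ /mapP[x xc ->] ->; exists [set x; next c x]; first exact: imset_f.
  by rewrite next_map //= imsetU1 imset_set1.
case=> _ /imsetP[x xc ->] ->; exists (h x); first exact: map_f.
by rewrite next_map //= imsetU1 imset_set1.
Qed.

(** [f] only ranges over graphs on ordinals. Relabelling vertices by [enum_rank] keeps the number of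
    edges, and cycles of the relabelled graph pull back to cycles of [E] of the same length. *)
Lemma card_le_f (T : finType) (E : {set {set T}}) :
  is_simple_graph E -> distinct_cycle_lengths E -> (#|E| <= f #|T|)%N.
Proof.
move=> sE dE.
pose g : T -> 'I_#|T| := enum_rank; pose h : 'I_#|T| -> T := enum_val.
have gK : cancel g h := @enum_rankK T.
have hK : cancel h g := @enum_valK T.
have injg := can_inj gK; have injh := can_inj hK.
pose E' : {set {set 'I_#|T|}} := [set g @: (e : {set T}) | e in E].
have adjE' i j : adj E' i j = adj E (h i) (h j).
  have eqg : [set i; j] = g @: [set h i; h j].
    by rewrite imsetU1 imset_set1 !hK.
  by rewrite /adj eqg mem_imset //; exact: imset_inj.
have cycE' c : is_cycle E' c -> is_cycle E (map h c).
  rewrite /is_cycle size_map /ucycleb => /and3P[-> cyc Uc] /=.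
  rewrite map_inj_uniq // Uc andbT.
  rewrite cycle_map; apply: sub_cycle cyc => i j.
  by rewrite /= adjE'.
rewrite -(card_imset E (imset_inj injg)) -/E'.
rewrite /f; apply: (leq_bigmax_cond (F := fun E : {set {set 'I_#|T|}} => #|E|)).
apply/asboolP; split.
  apply/forall_inP => _ /imsetP[e eE ->].
  by rewrite card_imset //; apply: (forall_inP sE).
move=> c1 c2 cy1 cy2 neq eqs.
have [/cycE' C1 /cycE' C2] := (cy1, cy2).
have [/and3P[_ _ U1] /and3P[_ _ U2]] := (cy1, cy2).
apply: (dE _ _ C1 C2); last by rewrite !size_map.
rewrite !cycle_edges_map // => eqh; apply: neq.
exact: (imset_inj (imset_inj injh) eqh).
Qed.

(** * Paths in a rooted forest *)

Section RootedTree.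
Variables (T : eqType) (x : T) (par : T -> T) (rk : T -> nat).
Hypothesis rk_par : forall v, v != x -> rk v = (rk (par v)).+1.

(** Tree adjacency with the root deleted, which leaves a forest; [rk] grows by one with each step
    away from the root. *)
Definition tadj : rel T :=
  fun u v => [&& u != x, v != x & (u == par v) || (v == par u)].

Lemma tadj_sym : symmetric tadj.
Proof. by move=> u v; rewrite /tadj orbC andbCA. Qed.

(* A path that starts by moving away from the root keeps doing so, since going
   back down would revisit a vertex. *)
Lemma rk_ascending w q :
  path tadj w q -> uniq (par w :: w :: q) -> rk (last w q) = (rk w + size q)%N.
Proof.
elim: q w => [|z q IH] w /=; first by rewrite addn0.
case/andP=> /and3P[wx zx /orP[/eqP wz|/eqP zw]] pq.
  case/andP=> _ Uq; rewrite IH // -?wz // (rk_par zx) -wz; lia.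
by rewrite zw !inE eqxx orbT.
Qed.

(** Had the first step led away from the root, [rk_ascending] would put the end strictly farther out
    than the start. *)
Lemma head_descending u w q :
  path tadj u (w :: q) -> uniq (u :: w :: q) ->
  (rk (last w q) <= rk u)%N -> w = par u.
Proof.
move=> /= /andP[/and3P[ux wx /orP[/eqP uw|/eqP //]] pq] Uq le.
have := rk_ascending pq; rewrite -uw => /(_ Uq).
move: (rk_par wx); rewrite -uw; lia.
Qed.

Lemma rev_tpath u q :
  path tadj u q -> path tadj (last u q) (rev (belast u q)).
Proof. by rewrite rev_path (eq_path tadj_sym). Qed.

(** This is [head_descending] for the reversed path. *)
Lemma last_ascending u q v :
  path tadj u (rcons q v) -> uniq (u :: rcons q v) ->
  (rk u <= rk v)%N -> last u q = par v.
Proof.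
move=> pq Uq le; have := rev_tpath pq.
rewrite last_rcons belast_rcons lastI rev_rcons => pr.
apply: head_descending pr _ _.
  by rewrite -rev_rcons -lastI -rev_rcons rev_uniq rcons_cons.
case: q {pq Uq} => //= z q.
by rewrite rev_cons last_rcons.
Qed.

(** Induction on the total length: an endpoint at least as far from the root as the other is
    followed by its parent on both paths, so the same edge can be removed from both. *)
Lemma tpath_unique u q1 q2 :
  path tadj u q1 -> path tadj u q2 -> uniq (u :: q1) -> uniq (u :: q2) ->
  last u q1 = last u q2 -> q1 = q2.
Proof.
have [n] := ubnP (size q1 + size q2).
elim: n u q1 q2 => // n IH u q1 q2.
have nil q : uniq (u :: q) -> last u q = u -> q = [::].
  case: q => //= z q /andP[uq _] zu; move: uq.
  by rewrite -zu mem_last.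
case: q1 => [|w1 q1].
  by move=> _ _ _ _ U2 /= /esym /(nil _ U2).
case: q2 => [|w2 q2]; first by move=> _ _ _ U1 _ /(nil _ U1).
have [le|lt] := leqP (rk (last u (w1 :: q1))) (rk u).
  move=> sz p1 p2 U1 U2 eql.
  have e1 := head_descending p1 U1 le.
  rewrite eql in le; have e2 := head_descending p2 U2 le.
  rewrite -e2 in e1; rewrite {}e1 in p1 U1 eql *.
  case/andP: p1 => _ p1; case/andP: p2 => _ p2.
  case/andP: U1 => _ U1; case/andP: U2 => _ U2.
  congr cons; apply: IH p1 p2 U1 U2 eql.
  move: sz => /=; lia.
move: lt; rewrite (lastI w1 q1) (lastI w2 q2).
move: (belast w1 q1) (last w1 q1) (belast w2 q2) (last w2 q2) => {w1 q1 w2 q2}.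
move=> q1 v q2 v2 lt sz p1 p2 U1 U2; rewrite !last_rcons => ev.
rewrite -{}ev in p2 U2 sz *; rewrite last_rcons in lt.
have e1 := last_ascending p1 U1 (ltnW lt).
have e2 := last_ascending p2 U2 (ltnW lt).
congr rcons; apply: (IH u).
- move: sz; rewrite !size_rcons; lia.
- by move: p1; rewrite rcons_path => /andP[].
- by move: p2; rewrite rcons_path => /andP[].
- by move: U1; rewrite -rcons_cons rcons_uniq => /andP[].
- by move: U2; rewrite -rcons_cons rcons_uniq => /andP[].
- by rewrite e1 e2.
Qed.

(** * Distances in the forest *)

Variables (conn : rel T) (d : T -> T -> nat).
Hypothesis conn_tadj : forall u v, tadj u v -> conn u =1 conn v.
Hypothesis conn_refl : forall u, conn u u.
Hypothesis conn_sym : symmetric conn.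
Hypothesis d_refl : forall u, d u u = 0%N.
Hypothesis d_sym : forall u v, d u v = d v u.
Hypothesis d_par : forall u v, u != x -> v != x -> u != v -> conn u v ->
  (rk v <= rk u)%N -> d u v = (d (par u) v).+1.

Lemma tpath_conn u q : path tadj u q -> conn u (last u q).
Proof.
elim: q u => [|w q IH] u /=; first by rewrite conn_refl.
by case/andP=> /conn_tadj -> /IH.
Qed.

(** The same peeling: the outer endpoint moves to its parent, where [d_par] lowers [d] by one. *)
Lemma size_tpath u q :
  u != x -> path tadj u q -> uniq (u :: q) -> size q = d u (last u q).
Proof.
have [n] := ubnP (size q).
elim: n u q => // n IH u [|w q] sz ux pq Uq; first by rewrite /= d_refl.
have xq : last w q != x.
  move: pq; rewrite (lastI w q) rcons_path => /andP[_ /and3P[_ + _]] //.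
have neq : u != last w q.
  by case/andP: Uq => uq _; apply: contraNneq uq => ->; apply: mem_last.
have cq := tpath_conn pq.
have [le|lt] := leqP (rk (last w q)) (rk u).
  have ew := head_descending pq Uq le.
  rewrite [last _ _]/= (d_par ux xq neq cq le) -ew /=; congr _.+1.
  case/andP: pq => /and3P[_ wx _] pq; case/andP: Uq => _ Uq.
  by apply: IH.
move: sz xq neq cq lt pq Uq; rewrite [last u _]/= (lastI w q).
move: (belast w q) (last w q) => {w} {}q v sz vx neq cq lt pq Uq.
have e1 := last_ascending pq Uq (ltnW lt).
rewrite d_sym d_par // 1?eq_sym 1?conn_sym ?(ltnW lt) //.
rewrite size_rcons -e1 d_sym; congr _.+1; apply: IH => //.
- by move: sz; rewrite size_rcons; lia.
- by move: pq; rewrite rcons_path => /andP[].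
- by move: Uq; rewrite -rcons_cons rcons_uniq => /andP[].
Qed.

End RootedTree.

(** * Fans glued at a root *)

(* The main path [m] has [len m] vertices and starts at a neighbour of the root;
   leg [l], with its [a l] edges, joins the [p l]-th vertex of [hub l] to the
   root. *)
Section FanGraph.
Variables (M L : finType) (len : M -> nat) (hub : L -> M) (p a : L -> nat).
Hypothesis p_gt0 : forall l, 0 < p l.
Hypothesis p_le : forall l, p l <= len (hub l).
Hypothesis a_gt1 : forall l, 1 < a l.

(** A leg ends at a main-path vertex and at the root, so its [a l] edges bring only [a l - 1] new
    vertices. *)
Definition branch_size (b : M + L) : nat :=
  match b with inl m => len m | inr l => (a l).-1 end.

Definition fan_vertex : finType := option {b : M + L & 'I_(branch_size b)}.

(** Heights start at 0, and those out of range yield the root [None]. *)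
Definition vertex_at (b : M + L) (h : nat) : fan_vertex :=
  if insub h is Some i then Some (existT (fun b => 'I_(branch_size b)) b i)
  else None.

Lemma vertex_at_eqP b h b' h' :
  h < branch_size b -> h' < branch_size b' ->
  vertex_at b h = vertex_at b' h' -> b = b' /\ h = h'.
Proof.
move=> hb hb' /(congr1 (fun v : fan_vertex =>
  (omap tag v, omap (fun u => nat_of_ord (tagged u)) v))).
by rewrite /vertex_at !insubT => -[].
Qed.

Lemma vertex_atP (v : fan_vertex) :
  v != None -> exists b h, h < branch_size b /\ v = vertex_at b h.
Proof.
case: v => // -[b i] _; exists b, (i : nat); split=> //.
by rewrite /vertex_at valK.
Qed.

Lemma vertex_at_neq b h : h < branch_size b -> vertex_at b h != None.
Proof. by move=> hb; rewrite /vertex_at insubT. Qed.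

Definition fan_branch (v : fan_vertex) : option (M + L) := omap tag v.

Definition fan_height (v : fan_vertex) : nat :=
  if v is Some u then nat_of_ord (tagged u) else 0.

Definition fan_parent (v : fan_vertex) : fan_vertex :=
  match fan_branch v, fan_height v with
  | None, _ | Some (inl _), 0 => None
  | Some (inr l), 0 => vertex_at (inl (hub l)) (p l).-1
  | Some b, h.+1 => vertex_at b h
  end.

(* Every vertex lies at distance [fan_leg v] above the vertex of its main path
   that has distance [fan_pos v] from the root. *)
Definition fan_pos (v : fan_vertex) : nat :=
  match fan_branch v with
  | None => 0 | Some (inl _) => (fan_height v).+1 | Some (inr l) => p l
  end.

Definition fan_leg (v : fan_vertex) : nat :=
  if fan_branch v is Some (inr _) then (fan_height v).+1 else 0.

Definition fan_rank v := fan_pos v + fan_leg v.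

Definition fan_hub (v : fan_vertex) : option M :=
  omap (fun b => match b with inl m => m | inr l => hub l end) (fan_branch v).

Definition natdist m n := (m - n) + (n - m).

(** Forest distance of two vertices of one fan: between different branches the route descends both
    legs and follows the main path. *)
Definition fan_dist u v :=
  if fan_branch u == fan_branch v then natdist (fan_rank u) (fan_rank v)
  else natdist (fan_pos u) (fan_pos v) + fan_leg u + fan_leg v.

Section At.
Variables (b : M + L) (h : nat).
Hypothesis hb : h < branch_size b.

Let atE : vertex_at b h = Some (existT _ b (Ordinal hb)).
Proof. by rewrite /vertex_at insubT. Qed.

Lemma fan_parent_at : fan_parent (vertex_at b h) =
  match b, h with
  | inl _, 0 => None
  | inr l, 0 => vertex_at (inl (hub l)) (p l).-1
  | _, h.+1 => vertex_at b h
  end.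
Proof. by rewrite atE; case: b hb. Qed.

Lemma fan_pos_at : fan_pos (vertex_at b h) =
  match b with inl _ => h.+1 | inr l => p l end.
Proof. by rewrite atE; case: b hb. Qed.

Lemma fan_leg_at : fan_leg (vertex_at b h) =
  match b with inl _ => 0 | inr l => h.+1 end.
Proof. by rewrite atE; case: b hb. Qed.

Lemma fan_branch_at : fan_branch (vertex_at b h) = Some b.
Proof. by rewrite atE; case: b hb. Qed.

Lemma fan_hub_at : fan_hub (vertex_at b h) =
  Some (match b with inl m => m | inr l => hub l end).
Proof. by rewrite atE; case: b hb. Qed.

End At.

Definition fan_atE :=
  (fan_parent_at, fan_pos_at, fan_leg_at, fan_branch_at, fan_hub_at).

Lemma hub_lt l : (p l).-1 < branch_size (inl (hub l)).
Proof. by have := p_gt0 l; have := p_le l; rewrite /=; lia. Qed.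

Lemma fan_rank_parent v : v != None ->
  fan_rank v = (fan_rank (fan_parent v)).+1.
Proof.
move=> /vertex_atP[b [h [hb ->]]]; rewrite /fan_rank.
case: b hb => [m|l]; case: h => [|h] hb; have /= hb' := hb;
  rewrite !fan_atE //= ?hub_lt ?(ltnW hb') //; try lia.
have := p_gt0 l; lia.
Qed.

Local Notation fan_adj := (tadj None fan_parent).

Lemma fan_hub_parent v : v != None -> fan_parent v != None ->
  fan_hub (fan_parent v) = fan_hub v.
Proof.
move=> /vertex_atP[b [h [hb ->]]].
case: b hb => [m|l]; case: h => [|h] hb; have /= hb' := hb;
  rewrite fan_parent_at //= => _; by rewrite !fan_atE ?hub_lt //= ltnW.
Qed.

Definition fan_conn : rel fan_vertex := fun u v => fan_hub u == fan_hub v.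

Lemma fan_conn_adj u v : fan_adj u v -> fan_conn u =1 fan_conn v.
Proof.
move=> /and3P[u0 v0 uv] w; rewrite /fan_conn; congr (_ == _).
case/orP: uv => /eqP e; first by rewrite e in u0 *; apply: fan_hub_parent.
by rewrite e in v0 *; apply/esym/fan_hub_parent.
Qed.

Lemma natdistC m n : natdist m n = natdist n m. Proof. exact: addnC. Qed.

Lemma fan_distC u v : fan_dist u v = fan_dist v u.
Proof. by rewrite /fan_dist eq_sym natdistC (natdistC (fan_pos u)) addnAC. Qed.

Lemma fan_dist_refl u : fan_dist u u = 0.
Proof. by rewrite /fan_dist eqxx /natdist subnn. Qed.

Lemma fan_dist_parent u v : u != None -> v != None -> u != v -> fan_conn u v ->
  fan_rank v <= fan_rank u -> fan_dist u v = (fan_dist (fan_parent u) v).+1.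
Proof.
move=> /vertex_atP[b [h [hb ->]]] /vertex_atP[b' [h' [hb' ->]]].
rewrite /fan_conn /fan_dist /fan_rank !fan_atE //.
have [eb|nb] := eqVneq b b'.
  case: _ / eb hb' => hb'.
  have [<-|nh _ _] := eqVneq h h'; first by rewrite eqxx.
  rewrite eqxx.
  case: b hb hb' => [m|l] hb hb' le.
    case: h hb nh le => [|h] hb nh le; first by lia.
    by rewrite !fan_atE ?eqxx /natdist /=; move: hb hb' => /=; lia.
  case: h hb nh le => [|h] hb nh le; first by lia.
  by rewrite !fan_atE ?eqxx /natdist /=; move: hb hb' => /=; lia.
move=> _ eh le.
have nb' : (Some b == Some b') = false by apply/negbTE.
rewrite nb'.
case: b hb nb nb' eh le => [m|l] hb nb nb' eh le.
  case: h hb le => [|h] hb le.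
    case: b' hb' nb nb' eh le => [m'|l'] hb' nb nb' /eqP[eh] le.
      by rewrite eh eqxx in nb.
    have := p_gt0 l'; lia.
  rewrite !fan_atE ?nb' ?(ltnW hb) //.
  case: b' hb' nb nb' eh le => [m'|l'] hb' nb nb' /eqP[eh] le.
    by rewrite eh eqxx in nb.
  rewrite /natdist; lia.
(* At the bottom of a leg the parent lies on the main path, possibly in the branch of [v]. *)
case: h hb le => [|h] hb le.
  rewrite !fan_atE ?hub_lt //.
  have pl := p_gt0 l.
  case: b' hb' nb nb' eh le => [m'|l'] hb' nb nb' /eqP[eh] le.
    by rewrite eh eqxx /natdist; lia.
  by rewrite /= /natdist; lia.
by rewrite !fan_atE ?nb' ?(ltnW hb) // addnS addSn.
Qed.

(* [fan_parent] is a spanning tree rooted at [None]; the remaining edges close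
   one cycle for every leg. *)
Definition leg_top l := vertex_at (inr l) (a l).-2.

Definition fan_edges : {set {set fan_vertex}} :=
  [set [set v; fan_parent v] | v in [set~ None]]
    :|: [set [set None; leg_top l] | l : L].

Lemma leg_top_lt l : (a l).-2 < branch_size (inr l).
Proof. by have := a_gt1 l; rewrite /=; lia. Qed.

Lemma fan_rank_leg_top l : 1 < fan_rank (leg_top l).
Proof.
rewrite /fan_rank /leg_top !fan_atE ?leg_top_lt //.
by have := p_gt0 l; lia.
Qed.

Lemma leg_top_neq l : leg_top l != None.
Proof. exact/vertex_at_neq/leg_top_lt. Qed.

Lemma fan_parent_neq v : v != None -> fan_parent v != v.
Proof.
by move=> /fan_rank_parent rv; apply/eqP => e; move: rv; rewrite e; lia.
Qed.

Lemma leg_top_inj : injective leg_top.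
Proof.
move=> l l' /vertex_at_eqP[] //; try exact: leg_top_lt.
by case.
Qed.

Lemma leg_top_parent l : fan_parent (leg_top l) != None.
Proof.
apply/eqP => e; have := fan_rank_leg_top l.
by rewrite (fan_rank_parent (leg_top_neq l)) e.
Qed.

Lemma set2_eqP (T : finType) (u v u' v' : T) :
  [set u; v] = [set u'; v'] -> (u = u' /\ v = v') \/ (u = v' /\ v = u').
Proof.
move=> /setP e.
have := e u; have := e v; have := e u'; have := e v'.
rewrite !inE !eqxx ?orbT /=.
do ![case: eqVneq => [->|_] //=]; auto.
Qed.

Lemma fan_edges_simple : is_simple_graph fan_edges.
Proof.
apply/forall_inP => e /setUP[] /imsetP[v].
  by rewrite !inE => v0 ->; rewrite cards2 (eq_sym v) fan_parent_neq.
by move=> _ ->; rewrite cards2 (eq_sym None) leg_top_neq.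
Qed.

Lemma card_fan_vertex :
  #|fan_vertex| = (\sum_m len m + \sum_l (a l).-1).+1.
Proof.
rewrite card_option card_tagged sumnE big_map big_enum /= big_sumType /=.
by congr (_ + _).+1; apply: eq_bigr => i _; rewrite card_ord.
Qed.

(** A tree edge determines its end of larger rank, so there is one per vertex other than the root.
    An edge from the root to a leg top is no tree edge, since the parent of a leg top is not the
    root. *)
Lemma card_fan_edges : #|fan_edges| = #|fan_vertex|.-1 + #|L|.
Proof.
rewrite /fan_edges cardsU disjoint_setI0 ?cards0 ?subn0.
  congr (_ + _).
    rewrite card_in_imset ?cardsC1 // => v w; rewrite !inE => v0 w0.
    case/set2_eqP=> -[// vw wv].
    have := fan_rank_parent v0; have := fan_rank_parent w0.
    by rewrite -vw wv; lia.
  rewrite card_imset // => l l' /set2_eqP[][].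
    by move=> _ /leg_top_inj.
  by move=> /esym/eqP; rewrite (negPf (leg_top_neq _)).
rewrite -setI_eq0; apply/eqP/setP => e; rewrite in_set0.
apply/negbTE/negP => /setIP[/imsetP[v]]; rewrite !inE => v0 ->.
case/imsetP=> l _ /set2_eqP[] [e1 e2]; first by rewrite e1 eqxx in v0.
by have := leg_top_parent l; rewrite -e1 e2 eqxx.
Qed.

Lemma adj_fan u v : u != None -> v != None -> adj fan_edges u v -> fan_adj u v.
Proof.
move=> u0 v0 /setUP[] /imsetP[w].
  rewrite /tadj u0 v0 /= => _ /set2_eqP[] [-> ->]; by rewrite eqxx ?orbT.
by move=> _ /set2_eqP[] [e1 e2]; [rewrite e1 in u0 | rewrite e2 in v0].
Qed.

Lemma adj_fan_root y : adj fan_edges None y ->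
  (exists2 m, 0 < len m & y = vertex_at (inl m) 0) \/ exists l, y = leg_top l.
Proof.
case/setUP=> /imsetP[w]; last first.
  by move=> _ /set2_eqP[] [e1 e2]; right; exists w => //; have := leg_top_neq w;
     rewrite -e1.
rewrite !inE => w0 /set2_eqP[] [e1 e2]; first by rewrite -e1 in w0.
have rw := fan_rank_parent w0; rewrite -e1 -[fan_rank None]/0 -e2 in rw.
rewrite -e2 in w0; left.
case/vertex_atP: w0 rw => b [h [hb ->]]; rewrite /fan_rank !fan_atE //.
case: b hb => [m|l] hb /=; last by have := p_gt0 l; lia.
by case: h hb => [|h] hb; [exists m | lia].
Qed.

Definition port (o : option L) l :=
  if o is Some l' then leg_top l' else vertex_at (inl (hub l)) 0.

Definition ports (o : option L) l :=
  if o is Some l' then (l' != l) && (hub l' == hub l) else true.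

Definition fan_cycle_length (o : option L) l :=
  if o is Some l' then a l' + a l + natdist (p l') (p l) else p l + a l.

Lemma hub_gt0 l : 0 < branch_size (inl (hub l)).
Proof. exact: leq_trans (p_gt0 l) (p_le l). Qed.

(** The two edges at the root complete the forest path from the port to the leg top. *)
Lemma fan_dist_port o l : ports o l ->
  (fan_dist (port o l) (leg_top l)).+2 = fan_cycle_length o l.
Proof.
rewrite /fan_dist /fan_rank /leg_top; have al := a_gt1 l.
case: o => [l'|] /=; last first.
  move=> _; rewrite /port !fan_atE ?leg_top_lt ?hub_gt0 //= /natdist.
  by have := p_gt0 l; lia.
case/andP=> neq _; rewrite /port /leg_top !fan_atE ?leg_top_lt //=.
have -> : (Some (inr l') == Some (inr l) :> option (M + L)) = false.
  by apply: contra_neqF neq => /eqP[].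
by have := a_gt1 l'; lia.
Qed.

Lemma port_neq o l : port o l != None.
Proof.
case: o => [l'|]; first exact: leg_top_neq.
exact/vertex_at_neq/hub_gt0.
Qed.

(** A cycle avoiding the root would give two forest paths from [u] to its predecessor: the long way
    round and a single edge. *)
Lemma fan_acyclic c : is_cycle fan_edges c -> None \in c.
Proof.
case/and3P=> sz cyc Uc; apply/negPn/negP => cN.
have N v : v \in c -> v != None by apply: contraTneq => ->.
case: c sz cyc Uc cN N => [|u [|w q]] // sz cyc Uc cN N.
have : path (adj fan_edges) u (rcons (w :: q) u) := cyc.
rewrite rcons_path => /andP[pq zu].
have zN : last u (w :: q) != None by apply: N; apply: mem_last.
have uN : u != None by apply: N; rewrite mem_head.
have p1 : path fan_adj u (w :: q).
  apply: (sub_in_path (P := fun v => v != None)) pq.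
    by move=> v v' /= v0 v0'; apply: adj_fan.
  by apply/allP => v; apply: N.
have p2 : path fan_adj u [:: last w q].
  by rewrite /= andbT tadj_sym; apply: adj_fan zu.
have U2 : uniq [:: u; last w q].
  rewrite /= inE andbT; case/andP: Uc => uq _.
  by apply: contraNneq uq => ->; apply: mem_last.
have := tpath_unique fan_rank_parent p1 p2 Uc U2 erefl.
by case=> _ q0; rewrite q0 in sz.
Qed.

(* A cycle through the root leaves it along a port [o], where [None] is the foot
   of the main path, and returns along the top of a leg [l]. *)
Lemma fan_cycleP c : is_cycle fan_edges c -> exists o l s,
  [/\ ports o l,
      [/\ path fan_adj (port o l) s, uniq (port o l :: s)
        & last (port o l) s = leg_top l],
      cycle_edges c = cycle_edges (None :: port o l :: s)
    & size c = fan_cycle_length o l].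
Proof.
move=> cyc; have Nc := fan_acyclic cyc; case/and3P: cyc => sz cyc Uc.
suff [o [l [s [ol [ps Us ls] ec sc]]]] : exists o l s,
    [/\ ports o l,
      [/\ path fan_adj (port o l) s, uniq (port o l :: s)
        & last (port o l) s = leg_top l],
      cycle_edges c = cycle_edges (None :: port o l :: s)
    & size c = (size s).+2].
  exists o, l, s; split=> //.
  rewrite sc -fan_dist_port // -ls; congr _.+2.
  apply: (size_tpath fan_rank_parent fan_conn_adj _ _ _ fan_distC) => //.
  - by move=> u; apply: eqxx.
  - by move=> u v; apply: eq_sym.
  - exact: fan_dist_refl.
  - exact: fan_dist_parent.
  - exact: port_neq.
(* Rotated to start at the root, the cycle is a forest path between two neighbours of the root. *)
case: (rot_to Nc) => i s ec.
rewrite -(cycle_edges_rot i Uc) -(size_rot i c) ec.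
rewrite -(size_rot i) ec in sz; rewrite -(rot_uniq i) ec in Uc.
rewrite -(rot_cycle i) ec in cyc => {ec Nc i c}.
case: s sz Uc cyc => [|y [|w s]] // _ Uc.
move: (w :: s) (isT : 0 < size (w :: s)) Uc => {w} {}s s_gt0 /andP[Ns Us].
rewrite (cycle_path None) /= => /and3P[adjz adjy pys].
have adjC : symmetric (adj fan_edges) by move=> u v; rewrite /adj setUC.
rewrite adjC in adjz.
have {}pys : path fan_adj y s.
  apply: (sub_in_path (P := fun v => v != None)) pys.
    by move=> u v /= u0 v0; apply: adj_fan.
  by apply/allP => v vs; apply: contraNneq Ns => <-.
have hubE : fan_hub y = fan_hub (last y s).
  apply/eqP; apply: (tpath_conn fan_conn_adj) pys.
  by move=> u; apply: eqxx.
have yz : y != last y s.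
  case: s s_gt0 Us {Ns adjz pys hubE} => // w s _ /andP[ys _].
  by apply: contraNneq ys => /= ->; apply: mem_last.
have hubT l : fan_hub (leg_top l) = Some (hub l).
  by rewrite /leg_top fan_hub_at ?leg_top_lt.
have hubB m : 0 < len m -> fan_hub (vertex_at (inl m) 0) = Some m.
  by move=> m0; rewrite fan_hub_at.
case: (adj_fan_root adjz) => [[m m0 zE]|[l zE]]; last first.
  rewrite zE hubT in hubE.
  case: (adj_fan_root adjy) => [[m' m0' yE]|[l' yE]].
    move: hubE; rewrite yE hubB // => -[mE]; subst m'.
    by exists None, l, s; rewrite /= -yE.
  exists (Some l'), l, s; rewrite /= -yE; split=> //.
  move: hubE; rewrite yE hubT => -[->]; rewrite eqxx andbT.
  by apply: contra_neq yz => ll; rewrite zE yE ll.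
(* Two feet in one fan coincide, against [yz]; a path from a leg top to the foot is read
   backwards. *)
case: (adj_fan_root adjy) => [[m' m0' yE]|[l' yE]].
  by move: hubE yz; rewrite zE yE !hubB // => -[->]; rewrite eqxx.
have mE : m = hub l' by move: hubE; rewrite zE yE hubB // hubT => -[].
exists None, l', (rev (belast y s)); rewrite /= -mE -zE.
have eqr : last y s :: rev (belast y s) = rev (y :: s).
  by rewrite [in RHS]lastI rev_rcons.
split=> //.
- split; [exact: rev_tpath | |].
    by rewrite -[_ && _]/(uniq (_ :: _)) eqr rev_uniq.
  rewrite -yE -[LHS]/(last y (last y s :: rev (belast y s))).
    by rewrite eqr rev_cons last_rcons.
- rewrite eqr -(cycle_edges_rot 1 (c := None :: rev (y :: s))); last first.
    by rewrite /= mem_rev Ns rev_uniq.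
  by rewrite rot1_cons -rev_cons cycle_edges_rev //= Ns.
- by rewrite size_rev size_belast.
Qed.

(** A code [(o, l)] determines its cycle because forest paths are unique. A cycle through two legs
    has two codes, one per direction, so injectivity up to this swap suffices. *)
Lemma le_f_fans :
  (forall o l o' l', ports o l -> ports o' l' ->
     fan_cycle_length o l = fan_cycle_length o' l' ->
     (o = o' /\ l = l') \/ (o = Some l' /\ o' = Some l)) ->
  \sum_m len m + \sum_l (a l).-1 + #|L|
    <= f (\sum_m len m + \sum_l (a l).-1).+1.
Proof.
move=> inj; rewrite -card_fan_vertex.
apply: leq_trans (card_le_f fan_edges_simple _).
  by rewrite card_fan_edges card_fan_vertex.
move=> c1 c2 /fan_cycleP[o1 [l1 [s1 [P1 [p1 U1 e1] -> ->]]]].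
move=> /fan_cycleP[o2 [l2 [s2 [P2 [p2 U2 e2] -> ->]]]] neq eqs; apply: neq.
have [[oE lE]|[oE lE]] := inj _ _ _ _ P1 P2 eqs.
  rewrite oE lE in p1 U1 e1 *; congr (cycle_edges (_ :: _ :: _)).
  by apply: (tpath_unique fan_rank_parent p1 p2 U1 U2); rewrite e1 e2.
(* Swapped codes: one path is the reversal of the other. *)
rewrite oE lE /= in p1 p2 U1 U2 e1 e2 *.
have N : None \notin leg_top l1 :: s2.
  have := p2; move: (leg_top_neq l1); rewrite inE negb_or eq_sym => -> /=.
  by elim: s2 (leg_top l1) {p2 U2 e2} => //= v s IH u /andP[/and3P[_ v0 _] /IH];
     rewrite inE negb_or eq_sym v0.
have eqr : leg_top l2 :: rev (belast (leg_top l1) s2) = rev (leg_top l1 :: s2).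
  by rewrite [in RHS]lastI e2 rev_rcons.
have -> : s1 = rev (belast (leg_top l1) s2).
  apply: (tpath_unique fan_rank_parent p1 _ U1).
  - by have := rev_tpath p2; rewrite e2.
  - by rewrite eqr rev_uniq.
  - rewrite -[RHS]/(last (leg_top l2) (leg_top l2 :: _)).
    by rewrite eqr rev_cons last_rcons.
rewrite eqr -(cycle_edges_rot 1 (c := None :: rev _)); last first.
  by rewrite /= mem_rev N rev_uniq.
by rewrite rot1_cons -rev_cons cycle_edges_rev //= N.
Qed.

End FanGraph.

(** * The design and its blow-up *)

(* Each inner list is a fan and each triple (U, V, e) a spoke; the first spoke
   of every fan, with U = V = 0 and e = false, is omitted.  The three groups are
   plain cycles, theta graphs, and two interleaved copies of a nine-spoke fan
   for the doubled scale. *)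
Definition design : seq (seq (nat * nat * bool)) :=
  [seq [:: (X, X, e)] | X <- iota 0 12, e <- [:: false; true]]
  ++ [:: [:: (12, 2, false); (18, 18, false)];
         [:: (12, 1, true); (17, 17, false)];
         [:: (13, 1, true); (19, 19, false)];
         [:: (13, 2, false); (19, 19, true)]]
  ++ [seq [seq (2 * s.1.1 + r, 2 * s.1.2, s.2)
            | s <- [:: (7, 0, true); (11, 6, true); (18, 6, false);
                       (20, 12, true); (22, 12, false); (25, 17, false);
                       (27, 22, false); (29, 29, false)]]
       | r <- [:: 0; 1]].

Definition spokes : seq (nat * (nat * nat * bool)) :=
  [seq (k, s) | k <- iota 0 (size design), s <- nth [::] design k].

Definition spoke j := nth (0, (0, 0, false)) spokes j.
Definition fan_of j := (spoke j).1.
Definition upper j := (spoke j).2.1.1.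
Definition lower j := (spoke j).2.1.2.
Definition parity j := (spoke j).2.2.
Definition last_spoke k := last (0, 0, false) (nth [::] design k).

(** [None] is the omitted first spoke, with V = 0 and even parity. *)
Definition cell (c : option nat * nat) : nat * bool :=
  let: (o, j) := c in
  if o is Some i then (upper j - lower i, parity i (+) parity j)
  else (upper j, parity j).

Definition base_cycles : seq (option nat * nat) :=
  [seq (None, j) | j <- iota 0 (size spokes)]
  ++ [seq c <- [seq (Some i, j) | j <- iota 0 (size spokes), i <- iota 0 j]
     | fan_of (odflt 0 c.1) == fan_of c.2].

Lemma size_spokes : size spokes = 48. Proof. by []. Qed.

(** The property the design was built for, checked by computation. *)
Lemma cell_uniq : uniq [seq cell c | c <- base_cycles].
Proof. by vm_compute. Qed.

(** The last clause will keep every foot on a main path that ends at the foot of the last spoke. *)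
Lemma spokeP j : j < 48 ->
  let s := last_spoke (fan_of j) in
  [&& fan_of j < 30, lower j <= upper j
    & (upper j + lower j < s.1.1 + s.1.2) || (spoke j == (fan_of j, s))].
Proof.
move=> j48 /=; have : j \in iota 0 48 by rewrite mem_iota.
by move: j {j48}; apply/allP; vm_compute.
Qed.

(** Spokes of a fan are listed in the order of their feet, and the truncated subtraction in [cell]
    is a true one. *)
Lemma fan_monotone i j : i < j < 48 -> fan_of i = fan_of j ->
  [&& upper i + lower i < upper j + lower j & lower i <= upper j].
Proof.
case/andP=> ij j48 fij.
have : all (fun j => all (fun i => (fan_of i == fan_of j) ==>
    [&& upper i + lower i < upper j + lower j & lower i <= upper j]) (iota 0 j))
  (iota 0 48) by vm_compute.
move=> /allP/(_ j); rewrite mem_iota => /(_ j48)/allP/(_ i).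
by rewrite mem_iota fij eqxx => /(_ ij).
Qed.

Lemma mem_base_cycles o j : j < 48 ->
  (if o is Some i then (i < j) && (fan_of i == fan_of j) else true) ->
  (o, j) \in base_cycles.
Proof.
move=> j48; rewrite mem_cat.
case: o => [i /andP[ij fij]|_]; apply/orP; [right|left].
  rewrite mem_filter; apply/andP; split=> //; apply/allpairsPdep.
  by exists j, i; rewrite !mem_iota size_spokes.
by apply/mapP; exists j; rewrite // mem_iota size_spokes.
Qed.

Lemma uniq_map_in_inj (T1 T2 : eqType) (h : T1 -> T2) s :
  uniq (map h s) -> {in s &, injective h}.
Proof.
move=> Us x y xs ys e.
have := uniqP (h x) Us (index x s) (index y s).
rewrite !inE size_map !index_mem !(nth_map x) ?index_mem // !nth_index //.
move=> /(_ xs ys e) eqi.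
by rewrite -[LHS](nth_index x xs) eqi nth_index.
Qed.

Section BlowUp.
Variables (t tail : nat).

(** The factor [t + 3] exceeds the spread of [i < t] and the parities, so different first
    coordinates of cells give disjoint ranges of lengths. The shift by 2 keeps arms longer than 1
    even when U = V. *)
Definition arm (j i : nat) := (t + 3) * (upper j - lower j) + (i + 2).
Definition foot (j i : nat) :=
  (t + 3) * (upper j + lower j) + (i + 2) + parity j.

(* The main path [inl ord0] carries no spoke and absorbs the spare vertices. *)
Definition blow_len (m : 'I_1 + 'I_30 * 'I_t) : nat :=
  match m with
  | inl _ => tail
  | inr (k, i) => let s := last_spoke k in
      (t + 3) * (s.1.1 + s.1.2) + (i + 2) + s.2
  end.

Definition blow_hub (l : 'I_48 * 'I_t) : 'I_1 + 'I_30 * 'I_t :=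
  inr (inord (fan_of l.1), l.2).

Definition blow_foot (l : 'I_48 * 'I_t) := foot l.1 l.2.
Definition blow_arm (l : 'I_48 * 'I_t) := arm l.1 l.2.

Lemma blow_foot_gt0 l : 0 < blow_foot l.
Proof. by rewrite /blow_foot /foot !addn_gt0 !orbT. Qed.

Lemma blow_arm_gt1 l : 1 < blow_arm l.
Proof. by rewrite /blow_arm /arm addnA addn2. Qed.

Lemma blow_foot_le l : blow_foot l <= blow_len (blow_hub l).
Proof.
case: l => j i; rewrite /blow_foot /foot /=.
have /and3P[f30 _] := spokeP (ltn_ord j); rewrite inordK //.
case/orP=> [lt|/eqP e]; last first.
  by rewrite /upper /lower /parity e.
set S := _.1.1 + _ in lt *.
(* One unit of U + V is worth [t + 3], which absorbs the parity bit. *)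
have : (t + 3) * (upper j + lower j).+1 <= (t + 3) * S.
  by rewrite leq_mul2l lt orbT.
by rewrite mulnS; case: (parity j); lia.
Qed.

Local Notation blow_ports := (ports blow_hub).
Local Notation blow_cycle_length := (fan_cycle_length blow_foot blow_arm).

(** Parity of the spoke with the earlier foot; it enters the cycle length negatively. *)
Definition low (o : option nat) : bool :=
  if o is Some i then parity i else false.

(* [o0] and [j0] are the two spokes of the cycle, listed in the order of their
   feet. *)
Lemma blow_cycleP o l : blow_ports o l -> exists o0 j0 (i : 'I_t),
  [/\ (o0, nat_of_ord j0) \in base_cycles,
      blow_cycle_length o l + low o0
        = 2 * ((t + 3) * (cell (o0, nat_of_ord j0)).1 + (i + 2)) + parity j0
    & (o0 = omap (fun l => nat_of_ord l.1) o /\ l = (j0, i)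
         /\ (forall l', o = Some l' -> l'.2 = i))
      \/ (o = Some (j0, i) /\ o0 = Some (nat_of_ord l.1) /\ l.2 = i)].
Proof.
case: l => j i; case: o => [[j' i']|] /=; last first.
  move=> _; exists None, j, i; split; last by left.
    exact: mem_base_cycles.
  rewrite /blow_foot /blow_arm /foot /arm /=.
  have /and3P[_ le _] := spokeP (ltn_ord j).
  have : (t + 3) * (upper j + lower j) + (t + 3) * (upper j - lower j)
      = 2 * ((t + 3) * upper j).
    by rewrite -mulnDr mulnCA; congr (_ * _); lia.
  lia.
case/andP=> neq /eqP[ef ei].
have {}ef : fan_of j' = fan_of j.
  have /and3P[f30 _ _] := spokeP (ltn_ord j).
  have /and3P[f30' _ _] := spokeP (ltn_ord j').
  by move/(congr1 val): ef; rewrite /= !inordK.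
rewrite ei in neq *.
(* With the foot of [u] before that of [v], the arms and the path between the feet add up to (foot +
   arm) of [v] minus (foot - arm) of [u]. *)
have key u v : u < v < 48 -> fan_of u = fan_of v ->
    arm u i + arm v i + natdist (foot u i) (foot v i) + parity u
    = 2 * ((t + 3) * (upper v - lower u) + (i + 2)) + parity v.
  move=> uv fuv; have /andP[lt le] := fan_monotone uv fuv.
  case/andP: uv => uv v48.
  have /and3P[_ leu _] := spokeP (ltn_trans uv v48).
  have /and3P[_ lev _] := spokeP v48.
  have : (t + 3) * (upper u + lower u).+1 <= (t + 3) * (upper v + lower v).
    by rewrite leq_mul2l lt orbT.
  have : (t + 3) * (upper v + lower v) + (t + 3) * (upper v - lower v)
        + (t + 3) * (upper u - lower u)
      = 2 * ((t + 3) * (upper v - lower u)) + (t + 3) * (upper u + lower u).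
    rewrite mulnCA -!mulnDr; congr (_ * _); lia.
  rewrite /natdist /arm /foot mulnS; case: (parity u); case: (parity v); lia.
have nj : nat_of_ord j' != j by apply: contraNneq neq => /ord_inj ->.
case: (ltngtP j' j) nj => // lt _.
  exists (Some (nat_of_ord j')), j, i; split.
  - by apply: mem_base_cycles => //; rewrite lt ef eqxx.
  - by rewrite /= /blow_arm /blow_foot /= key // lt /=.
  - by left; split=> //; split=> // l' [<-].
exists (Some (nat_of_ord j)), j', i; split.
- by apply: mem_base_cycles => //; rewrite lt ef eqxx.
- rewrite /= /blow_arm /blow_foot /= natdistC (addnC (arm j' i)) key // lt //=.
- by right.
Qed.

(** Decoding a length: its parity is the second coordinate of the cell, its block of width 2(t+3)
    the first; [cell_uniq] then gives the base cycle, and the remainder gives [i]. *)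
Lemma blow_cycle_length_inj o l o' l' : blow_ports o l -> blow_ports o' l' ->
  blow_cycle_length o l = blow_cycle_length o' l' ->
  (o = o' /\ l = l') \/ (o = Some l' /\ o' = Some l).
Proof.
move=> /blow_cycleP[a [j [i [aj La H]]]].
move=> /blow_cycleP[a' [j' [i' [aj' La' H']]]].
move=> eL; rewrite {}eL in La.
have cellE x y : (cell (x, y)).2 = low x (+) parity y.
  by case: x => //=; rewrite addFb.
have c2 : (cell (a, nat_of_ord j)).2 = (cell (a', nat_of_ord j')).2.
  rewrite !cellE; move: La La'.
  by case: (low a); case: (low a'); case: (parity j); case: (parity j') => //=;
     lia.
have i_lt := ltn_ord i; have i_lt' := ltn_ord i'.
have c1 : (cell (a, nat_of_ord j)).1 = (cell (a', nat_of_ord j')).1.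
  move: c2 La La'; rewrite !cellE.
  move: (cell _).1 (cell _).1 => X X'.
  have lt Y Y' : Y < Y' -> (t + 3) * Y + (t + 3) <= (t + 3) * Y'.
    by move=> YY'; rewrite -mulnSr leq_mul2l YY' orbT.
  by case: (ltngtP X X') => // /lt; case: (low a); case: (low a');
     case: (parity j); case: (parity j') => //=; lia.
have ec : (a, nat_of_ord j) = (a', nat_of_ord j').
  apply: (uniq_map_in_inj cell_uniq) => //.
  by rewrite [LHS]surjective_pairing c1 c2 -surjective_pairing.
case: ec => ea /ord_inj ej; subst a' j'.
have ei : i = i' by apply: val_inj => /=; lia.
subst i'; move: H H' {La La' aj aj' c1 c2}.
case=> [[ao [lj oi]]|[oj [al li]]]; case=> [[ao' [lj' oi']]|[oj' [al' li']]].
- left; split; last by rewrite lj lj'.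
  rewrite ao in ao'; move: ao' oi oi' {ao}.
  case: o o' => [[u v]|] [[u' v']|] //= [/ord_inj ->].
  by move=> /(_ _ erefl) /= -> /(_ _ erefl) /= ->.
- right; split; last by rewrite oj' lj.
  rewrite ao in al'; case: o al' oi {ao} => [[u v]|] //= [/ord_inj ->].
  by case: l' li' {oj'} => u' v' /= -> /(_ _ erefl) /= ->.
- right; split; first by rewrite oj lj'.
  rewrite al in ao'.
  case: o' ao' oi' => [[u v]|] //= [/ord_inj <-] /(_ _ erefl) /= ->.
  by case: l li {oj al} => u' v' /= ->.
- left; rewrite oj oj'; split=> //.
  rewrite al in al'; case: al' => /ord_inj e.
  by rewrite (surjective_pairing l) (surjective_pairing l') e li li'.
Qed.

(** * Size of the blow-up *)

Lemma sum_ord_double n : 2 * \sum_(i < n) i = n * n.-1.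
Proof.
by elim: n => [|n IH]; rewrite ?big_ord0 // big_ord_recr mulnDr IH /=; nia.
Qed.

Lemma sum_affine (m : nat) (c d : nat -> nat) e :
  \sum_(x : 'I_m * 'I_t) ((t + 3) * c x.1 + (x.2 + e) + d x.1)
  = t * ((t + 3) * \sum_(k < m) c k + m * e + \sum_(k < m) d k)
    + m * \sum_(i < t) i.
Proof.
rewrite -(pair_bigA _
  (fun (k : 'I_m) (i : 'I_t) => (t + 3) * c k + (i + e) + d k)) /=.
under eq_bigr => k _ do rewrite !big_split /= !sum_nat_const card_ord.
rewrite !big_split /= !sum_nat_const !card_ord -!big_distrr /=.
rewrite -!mulnDr; ring.
Qed.

(** Over the last spokes of the 30 fans, U + V totals 643 and 13 parities are odd. *)
Lemma sum_blow_len :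
  \sum_m blow_len m = tail
    + (t * ((t + 3) * 643 + 30 * 2 + 13) + 30 * \sum_(i < t) i).
Proof.
rewrite big_sumType big_ord1; congr (_ + _).
transitivity (\sum_(x : 'I_30 * 'I_t)
  ((t + 3) * ((last_spoke x.1).1.1 + (last_spoke x.1).1.2) + (x.2 + 2)
   + (last_spoke x.1).2)).
  by apply: eq_bigr => -[].
rewrite (sum_affine _ (fun k => (last_spoke k).1.1 + (last_spoke k).1.2)
  (fun k => (last_spoke k).2 : nat)).
rewrite -(big_mkord xpredT (fun k => (last_spoke k).1.1 + (last_spoke k).1.2)).
rewrite -(big_mkord xpredT (fun k => (last_spoke k).2 : nat)).
by congr (t * (_ * _ + _ + _) + _); rewrite unlock.
Qed.

(** Over the 48 spokes, U - V totals 272. *)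
Lemma sum_blow_arm :
  \sum_l (blow_arm l).-1
  = t * ((t + 3) * 272 + 48 * 1) + 48 * \sum_(i < t) i.
Proof.
transitivity (\sum_(x : 'I_48 * 'I_t)
  ((t + 3) * (upper x.1 - lower x.1) + (x.2 + 1) + 0)).
  apply: eq_bigr => -[j i] _.
  by rewrite /blow_arm /arm /= addn0 addn1 addn2 addnS.
rewrite (sum_affine _ (fun k => upper k - lower k) (fun=> 0)).
rewrite sum_nat_const muln0 addn0.
rewrite -(big_mkord xpredT (fun k => upper k - lower k)).
by congr (t * (_ * _ + _) + _); rewrite unlock.
Qed.

End BlowUp.

(** Without root and tail there are 915t(t+3) + 121t + 78t(t-1)/2 = 954t^2 + 2827t vertices. The
    tail pads to [n], and each of the 48t legs adds an edge. *)
Lemma le_f_design n t :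
  954 * t ^ 2 + 2827 * t < n -> n.-1 + 48 * t <= f n.
Proof.
move=> lt.
set tail := n.-1 - (954 * t ^ 2 + 2827 * t).
have le_f := le_f_fans (@blow_foot_gt0 t) (@blow_foot_le t tail)
          (@blow_arm_gt1 t) (@blow_cycle_length_inj t).
rewrite sum_blow_len sum_blow_arm card_prod !card_ord in le_f.
have eN : tail + (t * ((t + 3) * 643 + 30 * 2 + 13) + 30 * \sum_(i < t) i)
    + (t * ((t + 3) * 272 + 48 * 1) + 48 * \sum_(i < t) i) = n.-1.
  rewrite {le_f} /tail; have := sum_ord_double t.
  by case: t lt => [|t] lt /=; nia.
by rewrite -[in f n](prednK (leq_ltn_trans (leq0n _) lt)) -eN.
Qed.

(* Imported only here because classical_sets shadows the lemmas of finset. *)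
From mathcomp Require Import all_classical all_reals all_analysis.
Import Order.TTheory GRing.Theory Num.Theory.
Import numFieldNormedType.Exports.
Local Open Scope classical_set_scope.
Local Open Scope ring_scope.

(** * Asymptotics *)

(* Numerals above 5000 are opaque to [lia] and [lra]. *)
Lemma numeral_factors : 87978%N = (66 * 1333)%N /\ 15957%N = (81 * 197)%N.
Proof. by split; apply/eqP; vm_compute. Qed.

Lemma natr_le_quadratic (R : realFieldType) (a b c t n : nat) :
  a%:R / 4 * t%:R ^+ 2 + b%:R * t%:R + c%:R / 4 <= n%:R :> R ->
  (a * t ^ 2 + 4 * b * t + c <= 4 * n)%N.
Proof.
by move=> le; rewrite -(ler_nat R) !natrD !natrM; lra.
Qed.

Lemma le_natr_affine (R : realFieldType) (a b t n m : nat) :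
  (3 * n + a * t + b <= 3 * m)%N ->
  n%:R + a%:R / 3 * t%:R + b%:R / 3 <= m%:R :> R.
Proof. by rewrite -(ler_nat R) !natrD !natrM; lra. Qed.

Lemma le_f_nat (r n : nat) : (1 <= r)%N ->
  (2119 * (1260 * r + 169) ^ 2 + 4 * 87978 * (1260 * r + 169) + 15957
    <= 4 * n)%N ->
  (3 * n + 107 * (1260 * r + 169) + 7 <= 3 * f n)%N.
Proof.
move=> r1; have [-> ->] := numeral_factors; move=> le.
(* The scale is about 937/1260 of [1260 * r + 169]: 48 * 937 exceeds (107/3) * 1260, while 954 *
   937^2 stays below (2119/4) * 1260^2. *)
have := @le_f_design n (937 * r + 126).
have lt : (954 * (937 * r + 126) ^ 2 + 2827 * (937 * r + 126) < n)%N by nia.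
have n0 := leq_ltn_trans (leq0n _) lt.
by move=> /(_ lt) {le lt}; lia.
Qed.

Lemma le_f_real (R : realType) (r n : nat) (t : R) : (1 <= r)%N ->
  t = (1260 * r + 169)%N%:R ->
  2119 / 4 * t ^+ 2 + 87978%N%:R * t + 15957%N%:R / 4 <= n%:R ->
  n%:R + 107 / 3 * t + 7 / 3 <= (f n)%:R.
Proof.
by move=> r1 -> le; apply/le_natr_affine/le_f_nat/(natr_le_quadratic le).
Qed.

(** Since (107/3)^2 exceeds 2.401 * 2119/4, the quadratic terms leave a surplus, and for [t] this
    large it covers the lower-order terms. *)
Lemma le_sqr_quadratic (R : realFieldType) (s t y : R) :
  1260 * (s + 1000) <= t -> 0 <= s ->
  y = 2119 / 4 * t ^+ 2 + 66 * 1333 * t + 81 * 197 / 4 ->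
  2401 / 1000 * (y + 1) <= (107 / 3 * t) ^+ 2.
Proof.
move=> t_ge s_ge0 ->; have : 1260 * 1000 * t <= t ^+ 2.
  by rewrite expr2 ler_wpM2r; lra.
by rewrite exprMn; lra.
Qed.

Lemma le_sqrt_ratio (R : rcfType) (c s x n : R) :
  0 <= c -> 0 <= s -> 0 < n -> c * n <= s ^+ 2 -> s <= x ->
  Num.sqrt c <= x / Num.sqrt n.
Proof.
move=> c0 s0 n0 le sx; rewrite ler_pdivlMr ?sqrtr_gt0 //; apply: le_trans sx.
by rewrite -sqrtrM // -[leRHS](ger0_norm s0) -sqrtr_sqr ler_sqrt // sqr_ge0.
Qed.

Lemma le_quadratic (R : realFieldType) (s t y : R) :
  1260 * (s + 1000) <= t -> 0 <= s ->
  y = 2119 / 4 * t ^+ 2 + 66 * 1333 * t + 81 * 197 / 4 -> s <= y.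
Proof. by move=> t_ge s_ge0 ->; have := sqr_ge0 t; lra. Qed.

Lemma ratio_not_cvg (R : realType) :
  ~ ((fun n : nat => ((f n)%:R - n%:R) / Num.sqrt (n%:R : R)) @ \oo
       --> Num.sqrt (24 / 10 : R)).
Proof.
move=> cvg_ratio.
(* The value 2.401 lies between 2.4 and the ratio 2.4013... reached at the thresholds. *)
have lt_sqrt : Num.sqrt (24 / 10 : R) < Num.sqrt (2401 / 1000).
  by rewrite ltr_sqrt; lra.
have [N _ ltN] := cvgr_lt _ cvg_ratio _ lt_sqrt.
(* The summand [N] pushes the threshold [y] past [N]; 1000 makes [t] large enough for
   [le_sqr_quadratic]. *)
pose r := (N + 1000)%N; pose t : R := (1260 * r + 169)%N%:R.
have r1 : (1 <= r)%N by rewrite addn_gt0 orbT.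
have t_ge : 1260 * (N%:R + 1000) <= t.
  by rewrite -natrD -natrM ler_nat leq_addr.
have N_ge0 : 0 <= N%:R :> R by [].
have t_ge0 : 0 <= t by [].
have tE : t = (1260 * r + 169)%N%:R by [].
clearbody t.
pose y : R := 2119 / 4 * t ^+ 2 + 87978%N%:R * t + 15957%N%:R / 4.
have yD : 2119 / 4 * t ^+ 2 + 87978%N%:R * t + 15957%N%:R / 4 = y by [].
have yE : y = 2119 / 4 * t ^+ 2 + 66 * 1333 * t + 81 * 197 / 4.
  by rewrite /y; have [-> ->] := numeral_factors; rewrite !natrM.
clearbody y.
have le_y := le_sqr_quadratic t_ge N_ge0 yE.
have y_ge := le_quadratic t_ge N_ge0 yE.
have /andP[] := truncn_itv (le_trans N_ge0 y_ge).
(* The first integer above the threshold, so [n <= y + 1]. *)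
set n := (Num.truncn y).+1.
rewrite -(lerD2r 1) natr1 -/n => n_le lt_n.
have := le_f_real r1 tE; rewrite yD => /(_ _ (ltW lt_n)) le_fn.
have Nn : (N <= n)%N by rewrite -(ler_nat R) (le_trans y_ge) ?ltW.
have := ltN n Nn; rewrite /= ltNge => /negP; apply.
apply: (@le_sqrt_ratio _ _ (107 / 3 * t)).
- exact: divr_ge0 (ler0n _ _) (ler0n _ _).
- exact: mulr_ge0 (divr_ge0 (ler0n _ _) (ler0n _ _)) t_ge0.
- by rewrite ltr0n.
- apply: le_trans le_y; apply: ler_wpM2l n_le.
  exact: divr_ge0 (ler0n _ _) (ler0n _ _).
- rewrite lerBrDl; apply: le_trans le_fn; rewrite lerDl.
  exact: divr_ge0 (ler0n _ _) (ler0n _ _).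
Qed.

Theorem theorem7 (R : realType) :
  (forall r : nat, (1 <= r)%N ->
     let t : R := (1260 * r + 169)%N%:R in
     forall n : nat,
       n%:R >= 2119 / 4 * t ^+ 2 + 87978%N%:R * t + 15957%N%:R / 4 ->
       (f n)%:R >= n%:R + 107 / 3 * t + 7 / 3)
  /\
  ~ ((fun n : nat => ((f n)%:R - n%:R) / Num.sqrt (n%:R : R)) @ \oo
       --> Num.sqrt (24 / 10 : R)).
Proof.
split; last exact: ratio_not_cvg.
by move=> r r1 t n le; apply: le_f_real r1 (erefl t) le.
Qed.
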